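(* For any integer $T$, any initialization $z_0=(x_0,y_0)\in\mathbb{R}^{d_x}\times\mathbb{R}^{d_y}$, and any asymmetric Krylov-subspace algorithm, there exists a bilinear min-max problem $$\min_{x\in\mathbb{R}^{d_x}}\max_{y\in\mathbb{R}^{d_y}}\ (x-\tilde x)^\top\mathbf{B}(y-\tilde y),$$ with all non-zero squared singular values of $\mathbf{B}$ in $[m,M]$, for which the initialization $z_0$ is not a saddle point and the algorithm's iterate $z_{2T}$ satisfies $$\|z_{2T}-z^*\|\ge R_T\,\|z_0-z^*\|$$ for all saddle points $z^*=(x^*,y^* )$.
   Context: Here $0<m\le M<\infty$ are given spectral bounds, $\kappa:=M/m$, and $$R_T:=\frac{2(\sqrt\kappa+1)^T(\sqrt\kappa-1)^T}{(\sqrt\kappa+1)^{2T}+(\sqrt\kappa-1)^{2T}}.$$ In the bilinear problem, $\tilde x\in\mathbb{R}^{d_x}$, $\tilde y\in\mathbb{R}^{d_y}$, and $\mathbf{B}\in\mathbb{R}^{d_x\times d_y}$. An iterative algorithm for a min-max problem $\min_x\max_y f(x,y)$ is an asymmetric Krylov-subspace algorithm if for all $t$ its $t$-th iterate $z_t=(x_t,y_t)$ satisfies $$x_t\in x_0+\mathrm{Span}\{\nabla_x f(x_s,y_s): s\in\{0,\dots,t-1\}\},\qquad y_t\in y_0+\mathrm{Span}\{\nabla_y f(x_s,y_s): s\in\{0,\dots,t-1\}\}.$$ A saddle point is a point $z^*=(x^*,y^* )$ with $f(x^*,y)\le f(x^*,y^* )\le f(x,y^* )$ for all $x,y$. $\|\cdot\|$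 is the Euclidean norm.
   Formalization: The dimensions are assumed to satisfy d_x > T and d_y > T; without this the claim fails when m < M (e.g. d_x = d_y = T = 1, where a Krylov algorithm can reach the saddle point exactly at z_2). T is a nonnegative integer. *)

(* Defs.v *)
From mathcomp Require Import all_boot all_order all_algebra.
From mathcomp Require Import all_classical all_reals all_analysis.

Set Implicit Arguments.
Unset Strict Implicit.
Unset Printing Implicit Defensive.

Import Order.TTheory GRing.Theory Num.Theory.
Import numFieldNormedType.Exports.

Local Open Scope ring_scope.

(* The library norm on matrices is the sup norm, hence this definition. *)
Definition l2norm (R : realType) (dx dy : nat)
    (z : 'cV[R]_dx * 'cV[R]_dy) : R :=
  Num.sqrt (\sum_i z.1 i 0 ^+ 2 + \sum_j z.2 j 0 ^+ 2).

Definition grad (R : realType) (d : nat) (g : 'cV[R]_d -> R^o)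
    (x : 'cV[R]_d) : 'cV[R]_d :=
  \col_i 'D_(delta_mx i 0) g x.

Definition grad_x (R : realType) (dx dy : nat)
    (f : 'cV[R]_dx -> 'cV[R]_dy -> R) (z : 'cV[R]_dx * 'cV[R]_dy) : 'cV[R]_dx :=
  grad (fun x => f x z.2) z.1.

Definition grad_y (R : realType) (dx dy : nat)
    (f : 'cV[R]_dx -> 'cV[R]_dy -> R) (z : 'cV[R]_dx * 'cV[R]_dy) : 'cV[R]_dy :=
  grad (fun y => f z.1 y) z.2.

Definition saddle_point (R : realType) (dx dy : nat)
    (f : 'cV[R]_dx -> 'cV[R]_dy -> R) (z : 'cV[R]_dx * 'cV[R]_dy) : Prop :=
  forall (x : 'cV[R]_dx) (y : 'cV[R]_dy),
    f z.1 y <= f z.1 z.2 /\ f z.1 z.2 <= f x z.2.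

Definition bilinear_obj (R : realType) (dx dy : nat)
    (xt : 'cV[R]_dx) (yt : 'cV[R]_dy) (B : 'M[R]_(dx, dy))
    (x : 'cV[R]_dx) (y : 'cV[R]_dy) : R :=
  ((x - xt)^T *m B *m (y - yt)) 0 0.

(* When dx <> dy, using B^T *m B rather than B *m B^T can only affect whether
   0 counts as a singular value. *)
Definition singular_value (R : realType) (dx dy : nat)
    (B : 'M[R]_(dx, dy)) (s : R) : Prop :=
  0 <= s /\ eigenvalue (B^T *m B) (s ^+ 2).

Definition asymmetric_krylov (R : realType) (dx dy : nat)
    (f : 'cV[R]_dx -> 'cV[R]_dy -> R)
    (z : nat -> 'cV[R]_dx * 'cV[R]_dy) : Prop :=
  forall t : nat,
    (z t).1 - (z 0%N).1 \in <<[seq grad_x f (z s) | s <- iota 0 t]>>%VS /\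
    (z t).2 - (z 0%N).2 \in <<[seq grad_y f (z s) | s <- iota 0 t]>>%VS.

(* An algorithm maps an objective and an initialization to the sequence of
   iterates. No oracle model is imposed: beyond the span condition, the iterates
   may depend arbitrarily on the objective, so adaptive step sizes are covered. *)
Definition asymmetric_krylov_algorithm (R : realType) (dx dy : nat)
    (A : ('cV[R]_dx -> 'cV[R]_dy -> R) -> 'cV[R]_dx * 'cV[R]_dy ->
         nat -> 'cV[R]_dx * 'cV[R]_dy) : Prop :=
  forall (xt : 'cV[R]_dx) (yt : 'cV[R]_dy) (B : 'M[R]_(dx, dy))
         (z0 : 'cV[R]_dx * 'cV[R]_dy),
    A (bilinear_obj xt yt B) z0 0%N = z0 /\
    asymmetric_krylov (bilinear_obj xt yt B) (A (bilinear_obj xt yt B) z0).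

Definition rate (R : realType) (kappa : R) (T : nat) : R :=
  2 * (Num.sqrt kappa + 1) ^+ T * (Num.sqrt kappa - 1) ^+ T /
  ((Num.sqrt kappa + 1) ^+ (2 * T) + (Num.sqrt kappa - 1) ^+ (2 * T)).

(* Main.v *)
Require Import Defs.
From mathcomp Require Import all_boot all_order all_algebra.
From mathcomp Require Import all_classical all_reals all_analysis.
From mathcomp Require Import ring lra.

(** Take [B] diagonal with squared singular values [lam 0, ..., lam T] and zeros
    elsewhere, centre the problem at [yt = y0] and at [xt = x0 - a], where [a]
    vanishes beyond index [T].  The gradients are [B (y - yt)] and
    [B^T (x - xt)], and [y] starts without error, so multiplying the error in [x]
    by [B B^T] takes two steps: after [2T] steps the error in [x]
    is [p (B B^T) a] for a polynomial [p] of degree at most [T] with [p(0) = 1]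
    ([krylov_poly]), whatever the algorithm does.  The part of the error in the
    kernels of [B] and [B^T], which depends on the chosen saddle point, never
    moves.  It is thus enough to choose the [lam i] in [[m, M]] and the weights
    [w i = a_i ^ 2] so that every such [p] satisfies
      [\sum_i w i * p (lam i) ^ 2 >= rate ^ 2 * \sum_i w i].

    The choice ([extremal_weights]) comes from duality with Chebyshev
    polynomials.  Let [P] be the Chebyshev polynomial of degree [T] of the
    interval [[m, M]], signed so that [P(0) > 0]; then [P(0) = 1 / rate].  The
    [lam i] are the [T + 1] points where [P] takes the values [1] and [-1]
    alternately.  Interpolation at these points gives [p(0) = \sum_i l i * p (lam i)]
    for all [p] of degree at most [T], and since the points lie on one side of
    [0], the coefficients [l i] alternate in sign as well.  With [w i = |l i|],
    applying this to [P] gives [\sum_i w i = 1 / rate], and applying it to [p]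
    turns [\sum_i w i * (p (lam i) - rate * P (lam i)) ^ 2 >= 0] into the bound
    ([alternation_dual]).  When [m = M] the nodes collapse, but then the rate is
    [0], or [1] if [T = 0], and any weights do. *)

Set Implicit Arguments.
Unset Strict Implicit.
Unset Printing Implicit Defensive.

Import Order.TTheory GRing.Theory Num.Theory.
Import numFieldNormedType.Exports.

Local Open Scope ring_scope.

(** * Interpolation at zero *)

Lemma lagrange_horner (F : fieldType) (n : nat) (x : 'I_n -> F)
    (x_inj : injective x) (p : {poly F}) (c : F) : (size p <= n)%N ->
  p.[c] = \sum_i p.[x i] * \prod_(j | j != i) ((c - x j) / (x i - x j)).
Proof.
move=> sz_p.
pose l (i : 'I_n) : {poly F} :=
  \prod_(j | j != i) ((x i - x j)^-1 *: ('X - (x j)%:P)).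
have lE i d : (l i).[d] = \prod_(j | j != i) ((d - x j) / (x i - x j)).
  by rewrite horner_prod; apply: eq_bigr => j _; rewrite !hornerE mulrC.
have l_node i k : (l i).[x k] = (i == k)%:R.
  rewrite lE; case: eqVneq => [->|neq_ik].
    rewrite big1 // => j neq_jk; rewrite divff // subr_eq0.
    by apply: contra neq_jk => /eqP/x_inj->.
  by rewrite (bigD1 k) 1?eq_sym //= subrr mul0r mul0r.
have sz_l i : (size (l i) <= n)%N.
  apply: leq_trans (size_poly_prod_leq _ _) _.
  rewrite leq_subLR.
  have -> : #|fun j : 'I_n => j != i| = n.-1.
    by rewrite cardC1 card_ord.
  have le2 j : j != i -> (size ((x i - x j)^-1 *: ('X - (x j)%:P)) <= 2)%N.
    by move=> _; apply: leq_trans (size_scale_leq _ _) _; rewrite size_XsubC.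
  apply: (@leq_ltn_trans (\sum_(j < n | j != i) 2)); first exact: leq_sum.
  rewrite sum_nat_const cardC1 card_ord muln2 -addnn ltn_add2l ltn_predL.
  exact: leq_ltn_trans (ltn_ord i).
suff -> : p = \sum_i p.[x i] *: l i.
  rewrite {1}horner_sum; apply: eq_bigr => i _; rewrite hornerZ lE; congr (_ * _).
  rewrite horner_sum (bigD1 i) //= hornerZ l_node eqxx mulr1 big1 ?addr0 // => j.
  by rewrite hornerZ l_node => /negPf->; rewrite mulr0.
apply/eqP; rewrite -subr_eq0; apply/eqP.
apply: (@roots_geq_poly_eq0 _ _ [seq x i | i <- enum 'I_n]).
- apply/allP => _ /mapP[k _ ->]; rewrite rootE hornerD hornerN horner_sum.
  rewrite (bigD1 k) //= hornerZ l_node eqxx mulr1 big1 ?addr0 ?subrr // => j.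
  by rewrite hornerZ l_node => /negPf->; rewrite mulr0.
- by rewrite map_inj_uniq ?enum_uniq.
- rewrite size_map size_enum_ord.
  apply: leq_trans (size_polyD _ _) _; rewrite size_polyN geq_max sz_p /=.
  apply: leq_trans (size_sum _ _ _) _; apply/bigmax_leqP => i _.
  exact: leq_trans (size_scale_leq _ _) (sz_l i).
Qed.

(** The [j]-th factor at [0] is negative exactly when the node [x j] lies
    below [x i], so the product has the sign [(-1) ^ i]. *)
Lemma lagrange0_sign (R : realFieldType) (n : nat) (x : 'I_n -> R)
    (x_gt0 : forall i, 0 < x i)
    (x_incr : forall i j : 'I_n, (i < j)%N -> x i < x j) (i : 'I_n) :
  0 <= (-1) ^+ i * \prod_(j | j != i) ((0 - x j) / (x i - x j)).
Proof.
have -> : (-1) ^+ i = \prod_(j | j != i) (-1) ^+ (j < i)%N :> R.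
  rewrite prodrXr; congr (_ ^+ _).
  rewrite (bigID (fun j : 'I_n => (j < i)%N)) /=.
  rewrite (eq_bigr (fun=> 1%N)) => [|j /andP[_ ->]//].
  rewrite [X in (_ + X)%N]big1 => [|j /andP[_ /negPf->]//].
  rewrite addn0 sum1_card.
  rewrite -[in LHS](card_ord i) -!sum1_card.
  rewrite (big_ord_widen n (fun=> 1%N)) ?(ltnW (ltn_ord i)) //.
  apply: eq_bigl => j; rewrite [RHS]andb_idl // => lt_ji.
  by apply: contraTneq lt_ji => ->; rewrite ltnn.
rewrite -big_split /= prodr_ge0 // => j neq_ji.
rewrite sub0r mulrA; case: ltnP => [lt_ji|le_ij].
  rewrite expr1 mulN1r opprK divr_ge0 ?(ltW (x_gt0 _)) //.
  by rewrite subr_ge0 ltW // x_incr.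
rewrite expr0 mul1r mulNr -mulrN -invrN opprB divr_ge0 ?(ltW (x_gt0 _)) //.
by rewrite subr_ge0 ltW // x_incr // ltn_neqAle le_ij andbT eq_sym.
Qed.

(** The weights are the absolute values of the Lagrange coefficients at [0].
    They form a dual certificate: their alternating signs match those of [P], so
    [P / P(0)] attains equality in the bound. *)
Lemma alternation_dual (R : realFieldType) (n : nat) (x : 'I_n -> R)
    (x_gt0 : forall i, 0 < x i)
    (x_incr : forall i j : 'I_n, (i < j)%N -> x i < x j)
    (P : {poly R}) (sz_P : (size P <= n)%N)
    (P_alt : forall i, P.[x i] = (-1) ^+ i) (P0_gt0 : 0 < P.[0]) :
  exists w : 'I_n -> R,
    [/\ forall i, 0 <= w i, \sum_i w i = P.[0]
      & forall p : {poly R}, (size p <= n)%N -> p.[0] = 1 ->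
          P.[0]^-1 <= \sum_i w i * p.[x i] ^+ 2].
Proof.
pose w (i : 'I_n) := (-1) ^+ i * \prod_(j | j != i) ((0 - x j) / (x i - x j)).
have x_inj : injective x.
  move=> i j eq_x; apply/val_inj; case: (ltngtP i j) => // /x_incr;
  by rewrite eq_x ltxx.
have interp (p : {poly R}) : (size p <= n)%N ->
    p.[0] = \sum_i w i * ((-1) ^+ i * p.[x i]).
  move=> sz_p; rewrite (lagrange_horner x_inj _ sz_p).
  apply: eq_bigr => i _; rewrite /w.
  rewrite [RHS]mulrACA -expr2 sqrr_sign mul1r mulrC //.
have sum_w : \sum_i w i = P.[0].
  rewrite (interp _ sz_P); apply: eq_bigr => i _.
  by rewrite P_alt -expr2 sqrr_sign mulr1.
exists w; split=> // [i|p sz_p p0]; first exact: lagrange0_sign.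
set r := P.[0]^-1.
(* The constraint [p.[0] = 1] is the inner product of [p] with the alternating
   signs, so the minimizer is [r] times those signs. *)
have : 0 <= \sum_i w i * (p.[x i] - r * (-1) ^+ i) ^+ 2.
  by apply: sumr_ge0 => i _; rewrite mulr_ge0 ?sqr_ge0 ?lagrange0_sign.
have -> : \sum_i w i * (p.[x i] - r * (-1) ^+ i) ^+ 2
    = \sum_i w i * p.[x i] ^+ 2 - r * 2 * p.[0] + r ^+ 2 * P.[0].
  rewrite (interp _ sz_p) -sum_w !mulr_sumr -sumrB -big_split /=.
  apply: eq_bigr => i _; rewrite sqrrB exprMn sqrr_sign mulr1 /=; ring.
have rP : r * P.[0] = 1 by rewrite mulVf ?gt_eqF.
by rewrite p0 mulr1 [r ^+ 2]expr2 -mulrA rP; lra.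
Qed.

(** * Chebyshev polynomials and the extremal spectrum *)

Fixpoint chebyshev (R : nzRingType) (n : nat) : {poly R} :=
  match n with
  | 0 => 1
  | 1 => 'X
  | (n1.+1 as n').+1 => 2 *: ('X * chebyshev R n') - chebyshev R n1
  end.

Lemma chebyshev_rec (R : nzRingType) (n : nat) :
  chebyshev R n.+2 = 2 *: ('X * chebyshev R n.+1) - chebyshev R n.
Proof. by []. Qed.

Lemma size_chebyshev (R : nzRingType) (n : nat) :
  (size (chebyshev R n) <= n.+1)%N.
Proof.
suff [] : (size (chebyshev R n) <= n.+1 /\ size (chebyshev R n.+1) <= n.+2)%N by [].
elim: n => [|n [IH0 IH1]]; first by rewrite /= size_poly1 size_polyX.
split=> //; rewrite chebyshev_rec.
apply: leq_trans (size_polyD _ _) _; rewrite size_polyN geq_max.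
apply/andP; split; last exact: leq_trans IH0 (leqW (leqnSn _)).
apply: leq_trans (size_scale_leq _ _) _.
apply: leq_trans (size_polyMleq _ _) _.
by rewrite size_polyX /= ltnS.
Qed.

(** Both classical closed forms of Chebyshev values, inside [[-1, 1]] and beyond
    it, are obtained by checking the same three-term recurrence. *)
Lemma chebyshev_unique (R : comNzRingType) (f : nat -> R) (c : R) :
  f 0 = 1 -> f 1%N = c -> (forall n, f n.+2 = 2 * (c * f n.+1) - f n) ->
  forall n, (chebyshev R n).[c] = f n.
Proof.
move=> f0 f1 fS n.
suff [] : (chebyshev R n).[c] = f n /\ (chebyshev R n.+1).[c] = f n.+1 by [].
elim: n => [|n [IH0 IH1]]; first by rewrite /= !hornerE f0 f1.
split=> //; rewrite chebyshev_rec fS -IH1 -IH0.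
by rewrite hornerD hornerN hornerZ hornerM hornerX.
Qed.

Lemma chebyshev_cos (R : realType) (n : nat) (t : R) :
  (chebyshev R n).[cos t] = cos (n%:R * t).
Proof.
apply: (@chebyshev_unique _ (fun n => cos (n%:R * t)));
  rewrite ?mul0r ?mul1r ?cos0 //.
move=> k.
have -> : k.+2%:R * t = k.+1%:R * t + t by rewrite -[in LHS]natr1; ring.
have -> : k%:R * t = k.+1%:R * t - t by rewrite -natr1; ring.
by rewrite cosD cosB; ring.
Qed.

Lemma chebyshev_joukowski (F : numFieldType) (n : nat) (q : F) : q != 0 ->
  (chebyshev F n).[(q + q^-1) / 2] = (q ^+ n + q ^- n) / 2.
Proof.
move=> q0; apply: (@chebyshev_unique _ (fun n => (q ^+ n + q ^- n) / 2)).
- by rewrite !expr0 invr1; field.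
- by rewrite !expr1.
move=> k; rewrite !exprS.
have qk0 : q ^+ k != 0 by rewrite expf_neq0.
by field; rewrite q0 qk0.
Qed.

Lemma cos_nat_pi (R : realType) (n : nat) : cos (n%:R * pi) = (-1) ^+ n :> R.
Proof.
elim: n => [|n IH]; first by rewrite mul0r cos0.
by rewrite -natr1 mulrDl mul1r cosDpi IH exprS mulN1r.
Qed.

(** The extremal points of the Chebyshev polynomial of [[m, M]], in increasing
    order from [m] to [M]. *)
Definition cheb_node (R : realType) (m M : R) (T i : nat) : R :=
  ((M + m) - (M - m) * cos (i%:R / T%:R * pi)) / 2.

Lemma cheb_node_itv (R : realType) (m M : R) (T i : nat) : m <= M ->
  m <= cheb_node m M T i <= M.
Proof.
move=> le_mM; rewrite /cheb_node.
set c := cos _; have := cos_le1 (i%:R / T%:R * pi : R).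
have := cos_geN1 (i%:R / T%:R * pi : R); rewrite -/c => h1 h2.
by apply/andP; split; nra.
Qed.

Lemma cheb_node_incr (R : realType) (m M : R) (T i j : nat) : m < M ->
  (i < j)%N -> (j <= T)%N -> cheb_node m M T i < cheb_node m M T j.
Proof.
move=> lt_mM lt_ij le_jT.
have T_gt0 : 0 < T%:R :> R.
  by rewrite ltr0n (leq_trans _ le_jT) // (leq_ltn_trans _ lt_ij).
have arg_itv k : (k <= T)%N -> k%:R / T%:R * pi \in `[0, pi : R].
  move=> le_kT; rewrite in_itv /= !mulr_ge0 ?ler0n ?invr_ge0 ?pi_ge0 //=.
  by rewrite ler_piMl ?pi_ge0 // ler_pdivrMr // mul1r ler_nat.
have : cos (j%:R / T%:R * pi) < cos (i%:R / T%:R * pi) :> R.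
  rewrite ltr_cos ?arg_itv ?(leq_trans (ltnW lt_ij)) //.
  by rewrite ltr_pM2r ?pi_gt0 // ltr_pM2r ?invr_gt0 // ltr_nat.
by rewrite /cheb_node => ?; nra.
Qed.

(** The affine substitution maps [[m, M]] onto [[-1, 1]] and reverses
    orientation, so that [0] goes to [(M + m) / (M - m) > 1] and the value at [0]
    is positive for every parity of [T]. *)
Definition cheb_itv (R : realType) (m M : R) (T : nat) : {poly R} :=
  chebyshev R T \Po (((M + m) / (M - m))%:P - (2 / (M - m)) *: 'X).

Lemma size_cheb_itv (R : realType) (m M : R) (T : nat) :
  (size (cheb_itv m M T) <= T.+1)%N.
Proof.
apply: leq_trans (size_comp_poly_leq _ _) _; rewrite ltnS.
set g := _ - _; have sz_g : ((size g).-1 <= 1)%N.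
  rewrite -subn1 leq_subLR; apply: leq_trans (size_polyD _ _) _.
  rewrite size_polyN geq_max (leq_trans (size_polyC_leq1 _)) //=.
  by rewrite (leq_trans (size_scale_leq _ _)) ?size_polyX.
apply: leq_trans (leq_mul (leqnn _) sz_g) _; rewrite muln1.
by rewrite -subn1 leq_subLR add1n size_chebyshev.
Qed.

Lemma cheb_itv_node (R : realType) (m M : R) (T i : nat) : m < M ->
  (i <= T)%N -> (cheb_itv m M T).[cheb_node m M T i] = (-1) ^+ i.
Proof.
move=> lt_mM le_iT; rewrite /cheb_itv horner_comp.
have -> : (((M + m) / (M - m))%:P - (2 / (M - m)) *: 'X).[cheb_node m M T i]
    = cos (i%:R / T%:R * pi).
  rewrite hornerD hornerN hornerC hornerZ hornerX /cheb_node.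
  by field; rewrite subr_eq0 gt_eqF.
rewrite chebyshev_cos -cos_nat_pi.
(* For [T = 0] the only node has index [0], and [0 / 0 = 0]. *)
case: T le_iT => [|T] le_iT.
  by move: le_iT; rewrite leqn0 => /eqP->; rewrite !mul0r.
by congr (cos _); field; rewrite ?pnatr_eq0.
Qed.

(** With [s = sqrt (M / m)], the image of [0] is
    [(s ^ 2 + 1) / (s ^ 2 - 1) = (q + q^-1) / 2] for [q = (s + 1) / (s - 1)],
    where the value is [(q ^ T + q ^- T) / 2]. *)
Lemma cheb_itv0 (R : realType) (m M : R) (T : nat) : 0 < m -> m < M ->
  0 < (cheb_itv m M T).[0] /\ (cheb_itv m M T).[0]^-1 = rate (M / m) T.
Proof.
move=> m_gt0 lt_mM.
have k_gt1 : 1 < M / m by rewrite ltr_pdivlMr ?mul1r.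
set s := Num.sqrt (M / m).
have s2 : s ^+ 2 = M / m by rewrite sqr_sqrtr // (le_trans _ (ltW k_gt1)).
have s_gt1 : 1 < s by rewrite -sqrtr1 ltr_sqrt // (lt_trans _ k_gt1).
have Ms : M = s ^+ 2 * m by rewrite s2 divfK ?gt_eqF.
have A_gt0 : 0 < (s + 1) ^+ T by rewrite exprn_gt0 // addr_gt0 // (lt_trans _ s_gt1).
have B_gt0 : 0 < (s - 1) ^+ T by rewrite exprn_gt0 // subr_gt0.
have sB : s - 1 != 0 by rewrite subr_eq0 gt_eqF.
have sA : s + 1 != 0 by rewrite gt_eqF // addr_gt0 // (lt_trans _ s_gt1).
have -> : (cheb_itv m M T).[0]
    = ((s + 1) ^+ T / (s - 1) ^+ T + (s - 1) ^+ T / (s + 1) ^+ T) / 2.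
  rewrite /cheb_itv horner_comp hornerD hornerN hornerC hornerZ hornerX mulr0 subr0.
  have -> : (M + m) / (M - m)
      = ((s + 1) / (s - 1) + ((s + 1) / (s - 1))^-1) / 2.
    rewrite Ms; field.
    by rewrite sA sB -Ms subr_eq0 (gt_eqF lt_mM).
  rewrite chebyshev_joukowski ?mulf_neq0 ?invr_eq0 //.
  by rewrite -exprVn invf_div !expr_div_n.
split; first by rewrite divr_gt0 // addr_gt0 // divr_gt0.
rewrite /rate -/s [(2 * T)%N]mulnC !exprM.
set a := (s + 1) ^+ T in A_gt0 *; set b := (s - 1) ^+ T in B_gt0 *.
have D_gt0 : 0 < a ^+ 2 + b ^+ 2 by rewrite addr_gt0 // exprn_gt0.
by field; rewrite (gt_eqF A_gt0) (gt_eqF B_gt0) (gt_eqF D_gt0).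
Qed.

Lemma rate_itv01 (R : realType) (k : R) (T : nat) : 1 <= k -> 0 <= rate k T <= 1.
Proof.
move=> k_ge1; rewrite /rate [(2 * T)%N]mulnC !exprM.
have s_ge1 : 1 <= Num.sqrt k.
  by rewrite -[leLHS]sqrtr1 ler_sqrt // (le_trans _ k_ge1).
have a_gt0 : 0 < (Num.sqrt k + 1) ^+ T.
  by rewrite exprn_gt0 // addr_gt0 // (lt_le_trans _ s_ge1).
have b_ge0 : 0 <= (Num.sqrt k - 1) ^+ T by rewrite exprn_ge0 // subr_ge0.
set a := (_ + 1) ^+ T in a_gt0 *; set b := _ ^+ T in b_ge0 *.
have den_gt0 : 0 < a ^+ 2 + b ^+ 2 by rewrite ltr_wpDr ?sqr_ge0 ?exprn_gt0.
rewrite divr_ge0 ?(ltW den_gt0) ?mulr_ge0 ?(ltW a_gt0) //=.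
rewrite ler_pdivrMr // mul1r.
by have := sqr_ge0 (a - b); nra.
Qed.

(** The polynomial content of the lower bound: a spectrum and an initial error on
    which no polynomial method of degree [T] beats the rate. *)
Lemma extremal_weights (R : realType) (m M : R) (T : nat) : 0 < m -> m <= M ->
  exists lam w : nat -> R,
    [/\ forall i, m <= lam i <= M, forall i, 0 <= w i, 0 < \sum_(i < T.+1) w i
      & forall p : {poly R}, (size p <= T.+1)%N -> p.[0] = 1 ->
          rate (M / m) T ^+ 2 * \sum_(i < T.+1) w i
            <= \sum_(i < T.+1) w i * p.[lam i] ^+ 2].
Proof.
move=> m_gt0; rewrite le_eqVlt => /predU1P[<-|lt_mM].
  exists (fun=> m), (fun=> 1); rewrite divff ?gt_eqF //.
  have sum_gt0 : 0 < \sum_(i < T.+1) 1 :> R by rewrite sumr_const card_ord ltr0n.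
  split=> [_|_||p sz_p p0] //; first by rewrite !lexx.
  rewrite -mulr_suml mulrC ler_pM2l //.
  case: T sz_p {sum_gt0} => [|T] sz_p.
    move: p0; rewrite (size1_polyC sz_p) !hornerC => ->.
    by rewrite /rate !muln0 !expr0 !mulr1 divff ?expr1n // gt_eqF.
  by rewrite /rate sqrtr1 subrr expr0n /= mulr0 mul0r expr0n sqr_ge0.
have [P0_gt0 P0V] := cheb_itv0 T m_gt0 lt_mM.
have [||P_alt|w [w_ge0 sum_w w_dual]] :=
    @alternation_dual _ T.+1 (fun i => cheb_node m M T i) _ _ _
      (size_cheb_itv m M T) _ P0_gt0.
- by move=> i; rewrite (lt_le_trans m_gt0) //;
  have /andP[] := cheb_node_itv T i (ltW lt_mM).
- by move=> i j lt_ij; rewrite cheb_node_incr // -ltnS ltn_ord.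
- by rewrite cheb_itv_node // -ltnS ltn_ord.
exists (cheb_node m M T), (fun i => w (inord i)).
have wE (F : nat -> R) : \sum_(i < T.+1) w (inord i) * F i
    = \sum_(i < T.+1) w i * F i.
  by apply: eq_bigr => i _; rewrite inord_val.
have sum_wE : \sum_(i < T.+1) w (inord i) = (cheb_itv m M T).[0].
  by rewrite -sum_w; apply: eq_bigr => i _; rewrite inord_val.
split=> [i|i||p sz_p p0]; rewrite ?sum_wE //; first exact/cheb_node_itv/ltW.
rewrite -P0V expr2 -mulrA mulVf ?gt_eqF // mulr1.
by rewrite (wE (fun i => p.[cheb_node m M T i] ^+ 2)); apply: w_dual.
Qed.

(** * Gradients and saddle points of bilinear problems *)

Lemma grad_affine (R : realType) (d : nat) (g : 'cV[R]_d -> R^o)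
    (c x : 'cV[R]_d) :
  (forall (h : R) (v : 'cV[R]_d), g (h *: v + x) - g x = h * (v^T *m c) 0 0) ->
  grad g x = c.
Proof.
move=> g_affine; apply/colP => i; rewrite mxE /derive.
apply: cvg_lim; first exact: norm_hausdorff.
apply: cvg_near_cst; near=> h.
have h_neq0 : h != 0 by near: h; exact: nbhs_dnbhs_neq.
rewrite /= g_affine /GRing.scale /= mulKf // trmx_delta -rowE mxE //.
Unshelve. all: by end_near. Qed.

Lemma grad_x_bilinear (R : realType) (dx dy : nat) (xt : 'cV[R]_dx)
    (yt : 'cV[R]_dy) (B : 'M[R]_(dx, dy)) (z : 'cV[R]_dx * 'cV[R]_dy) :
  grad_x (bilinear_obj xt yt B) z = B *m (z.2 - yt).
Proof.
apply: grad_affine => h v; rewrite /bilinear_obj -!mulmxA.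
rewrite -addrA linearD /= mulmxDl mxE addrK.
by rewrite linearZ /= -scalemxAl mxE.
Qed.

Lemma grad_y_bilinear (R : realType) (dx dy : nat) (xt : 'cV[R]_dx)
    (yt : 'cV[R]_dy) (B : 'M[R]_(dx, dy)) (z : 'cV[R]_dx * 'cV[R]_dy) :
  grad_y (bilinear_obj xt yt B) z = B^T *m (z.1 - xt).
Proof.
apply: grad_affine => h v; rewrite /bilinear_obj.
rewrite -addrA mulmxDr mxE addrK -scalemxAr mxE; congr (_ * _).
have tr1 (A : 'M[R]_1) : A 0 0 = A^T 0 0 by rewrite mxE.
by rewrite [LHS]tr1 !trmx_mul trmxK.
Qed.

(** Moving [y] along its gradient, or [x] against its gradient, changes the
    objective by the squared norm of that gradient, in the direction that a saddle
    point forbids. *)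
Lemma saddle_bilinear (R : realType) (dx dy : nat) (xt : 'cV[R]_dx)
    (yt : 'cV[R]_dy) (B : 'M[R]_(dx, dy)) (z : 'cV[R]_dx * 'cV[R]_dy) :
  saddle_point (bilinear_obj xt yt B) z ->
  B^T *m (z.1 - xt) = 0 /\ B *m (z.2 - yt) = 0.
Proof.
have sqr_le0 d (u : 'cV[R]_d) : (u^T *m u) 0 0 <= 0 -> u = 0.
  rewrite mxE => le0; apply/colP => i; rewrite mxE.
  have ge0 j : 0 <= u^T 0 j * u j 0 by rewrite mxE -expr2 sqr_ge0.
  have /eqP : \sum_j u^T 0 j * u j 0 = 0.
    by apply/le_anti; rewrite le0 sumr_ge0.
  rewrite psumr_eq0 // => /allP/(_ i); rewrite mem_index_enum => /(_ isT).
  by rewrite mxE mulf_eq0 orbb => /eqP.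
move=> z_saddle; split; apply: sqr_le0.
  have [le_f _] := z_saddle z.1 (B^T *m (z.1 - xt) + z.2).
  move: le_f; rewrite /bilinear_obj -addrA mulmxDr mxE gerDr.
  by rewrite !trmx_mul trmxK.
have [_ le_f] := z_saddle (- (B *m (z.2 - yt)) + z.1) z.2.
move: le_f; rewrite /bilinear_obj -addrA [(- _ + _)^T]linearD /=.
rewrite !mulmxDl [leRHS]mxE lerDr.
by rewrite linearN /= !mulNmx mxE oppr_ge0 -!mulmxA.
Qed.

(** * Rectangular diagonal matrices *)

Definition diag_rect (R : nzRingType) (dx dy : nat) (s : nat -> R) :
    'M[R]_(dx, dy) :=
  \matrix_(i, j) (s i *+ (i == j :> nat)).

Lemma tr_diag_rect (R : nzRingType) (dx dy : nat) (s : nat -> R) :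
  (diag_rect dx dy s)^T = diag_rect dy dx s.
Proof.
by apply/matrixP => i j; rewrite !mxE eq_sym; case: eqP => // ->.
Qed.

Lemma diag_rect_mul (R : comNzRingType) (dx dy : nat) (s : nat -> R)
    (v : 'cV[R]_dy) (i : 'I_dx) (j : 'I_dy) :
  i = j :> nat -> (diag_rect dx dy s *m v) i 0 = s i * v j 0.
Proof.
move=> eq_ij; rewrite mxE (bigD1 j) //= mxE eq_ij eqxx mulr1n big1 ?addr0 // => k.
by rewrite mxE eq_ij eq_sym => /negPf; rewrite -val_eqE => ->; rewrite mulr0n mul0r.
Qed.

Lemma diag_rect_mul0 (R : comNzRingType) (dx dy : nat) (s : nat -> R)
    (v : 'cV[R]_dy) (i : 'I_dx) :
  (dy <= i)%N -> (diag_rect dx dy s *m v) i 0 = 0.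
Proof.
move=> le_di; rewrite mxE big1 // => k _.
by rewrite mxE gtn_eqF ?mulr0n ?mul0r // (leq_trans (ltn_ord k)).
Qed.

Lemma diag_rect_mul_col (R : comNzRingType) (dx dy : nat) (s g : nat -> R) :
  (forall k, (dy <= k)%N -> s k = 0) ->
  diag_rect dx dy s *m (\col_j g j) = \col_i (s i * g i).
Proof.
move=> s0; apply/colP => i; rewrite [RHS]mxE; case: (ltnP i dy) => [lt_id|le_di].
  by rewrite (diag_rect_mul s _ (j := Ordinal lt_id)) // mxE.
by rewrite diag_rect_mul0 // s0 // mul0r.
Qed.

Lemma diag_rect_ker (R : comNzRingType) (dx dy : nat) (s : nat -> R)
    (v : 'cV[R]_dy) : (forall k, (dx <= k)%N -> s k = 0) ->
  diag_rect dx dy s *m v = 0 -> forall j : 'I_dy, s j * v j 0 = 0.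
Proof.
move=> s0 Bv0 j; case: (ltnP j dx) => [lt_jd|le_dj]; last by rewrite s0 ?mul0r.
by rewrite -(@diag_rect_mul R dx dy s v (Ordinal lt_jd)) // Bv0 mxE.
Qed.

Lemma singular_value_diag_rect (R : realType) (dx dy : nat) (s : nat -> R)
    (x : R) : singular_value (diag_rect dx dy s) x -> x != 0 ->
  exists j, (j < minn dx dy)%N /\ x ^+ 2 = s j ^+ 2.
Proof.
case=> _ /eigenvalueP[v] vB v_neq0 x_neq0.
have [j vj_neq0] : exists j, v 0 j != 0.
  by apply/rV0Pn.
have Bv : diag_rect dy dx s *m (diag_rect dx dy s *m v^T) = x ^+ 2 *: v^T.
  by rewrite -linearZ /= -vB !trmx_mul trmxK tr_diag_rect mulmxA.
have {Bv} : (diag_rect dy dx s *m (diag_rect dx dy s *m v^T)) j 0 = x ^+ 2 * v 0 j.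
  by rewrite Bv !mxE.
case: (ltnP j dx) => [lt_jd|le_dj]; last first.
  rewrite diag_rect_mul0 // => /esym/eqP.
  by rewrite mulf_eq0 sqrf_eq0 (negPf x_neq0) (negPf vj_neq0).
rewrite (diag_rect_mul s _ (j := Ordinal lt_jd)) //.
rewrite (diag_rect_mul s _ (j := j)) // mxE mulrA -expr2.
move=> /(mulIf vj_neq0) <-; exists j; split=> //.
by rewrite leq_min lt_jd ltn_ord.
Qed.

(** * Krylov iterates as polynomials *)

Lemma span_poly (R : fieldType) (d n : nat) (c mu : nat -> R)
    (X : seq 'cV[R]_d) :
  (forall x, x \in X -> exists2 q : {poly R}, (size q <= n)%N &
     x = \col_i (c i * q.[mu i])) ->
  forall x, x \in <<X>>%VS -> exists2 q : {poly R}, (size q <= n)%N &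
     x = \col_i (c i * q.[mu i]).
Proof.
elim: X => [|x0 X IH] X_poly x.
  rewrite span_nil memv0 => /eqP->; exists 0; first by rewrite size_poly0.
  by apply/colP => i; rewrite !mxE horner0 mulr0.
rewrite span_cons => /memv_addP[_ /vlineP[k ->]] [y /IH yX ->].
have [q0 sz_q0 ->] := X_poly x0 (mem_head _ _).
have [|q1 sz_q1 ->] := yX.
  by move=> y' y'X; apply: X_poly; rewrite in_cons y'X orbT.
exists (k *: q0 + q1).
  rewrite (leq_trans (size_polyD _ _)) // geq_max sz_q1 andbT.
  exact: leq_trans (size_scale_leq _ _) sz_q0.
by apply/colP => i; rewrite !mxE hornerD hornerZ; ring.
Qed.

(** A monomial in [x] needs a product [B B^T], hence two steps; this is why
    degrees grow like [t / 2].  Starting [y] at [yt] makes the even powers of [B]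
    live in the [x] block only and the odd ones in the [y] block only. *)
Lemma krylov_poly (R : realType) (dx dy : nat) (s a : nat -> R)
    (xt : 'cV[R]_dx) (yt : 'cV[R]_dy) (z : nat -> 'cV[R]_dx * 'cV[R]_dy) :
  (forall k, (dx <= k)%N -> s k = 0) -> (forall k, (dy <= k)%N -> s k = 0) ->
  asymmetric_krylov (bilinear_obj xt yt (diag_rect dx dy s)) z ->
  (z 0%N).1 - xt = \col_i a i -> (z 0%N).2 = yt ->
  forall t,
    (exists p : {poly R}, [/\ (size p <= t./2.+1)%N, p.[0] = 1 &
       (z t).1 - xt = \col_i (p.[s i ^+ 2] * a i)]) /\
    (exists2 q : {poly R}, (size q <= uphalf t)%N &
       (z t).2 - yt = \col_j (s j * a j * q.[s j ^+ 2])).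
Proof.
move=> sx sy z_krylov u0 v0; elim/ltn_ind => t IH.
have [x_span y_span] := z_krylov t; split.
- have [|q sz_q uE] := @span_poly _ _ t./2 (fun i => s i ^+ 2 * a i)
    (fun i => s i ^+ 2) _ _ _ x_span.
    move=> _ /mapP[r + ->]; rewrite mem_iota add0n /= => lt_rt.
    have [_ [q sz_q vE]] := IH r lt_rt.
    exists q.
      rewrite (leq_trans sz_q) //.
      by case: t lt_rt {IH x_span y_span} => // t; rewrite ltnS /= => /uphalf_leq.
    rewrite grad_x_bilinear vE
      (diag_rect_mul_col _ (fun j => s j * a j * q.[s j ^+ 2])) //.
    by apply/colP => i; rewrite !mxE; ring.
  exists (1 + 'X * q); split.
  + rewrite (leq_trans (size_polyD _ _)) // size_poly1 geq_max /=.
    by rewrite (leq_trans (size_polyMleq _ _)) // size_polyX.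
  + by rewrite !hornerE.
  + rewrite -[LHS](subrKA (z 0%N).1) uE u0.
    by apply/colP => i; rewrite !mxE !hornerE; ring.
- have [|q sz_q vE] := @span_poly _ _ (uphalf t) (fun i => s i * a i)
    (fun i => s i ^+ 2) _ _ _ y_span.
    move=> _ /mapP[r + ->]; rewrite mem_iota add0n /= => lt_rt.
    have [[p [sz_p _ uE]] _] := IH r lt_rt.
    exists p.
      rewrite (leq_trans sz_p) //.
      by case: t lt_rt {IH x_span y_span} => // t; rewrite !ltnS => /half_leq.
    rewrite grad_y_bilinear uE tr_diag_rect
      (diag_rect_mul_col _ (fun j => p.[s j ^+ 2] * a j)) //.
    by apply/colP => i; rewrite !mxE; ring.
  by exists q => //; rewrite -v0.
Qed.

(** * The lower bound *)

Lemma sum_sqrD_orthogonal (R : comNzRingType) (n : nat) (u c : 'I_n -> R) :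
  (forall i, u i * c i = 0) ->
  \sum_i (u i + c i) ^+ 2 = \sum_i u i ^+ 2 + \sum_i c i ^+ 2.
Proof.
move=> uc0; rewrite -big_split; apply: eq_bigr => i _ /=.
by rewrite sqrrD uc0 mul0rn addr0.
Qed.

Lemma big_ord_supp (V : nmodType) (T n : nat) (F : nat -> V) : (T < n)%N ->
  (forall i, (T < i)%N -> F i = 0) -> \sum_(i < n) F i = \sum_(i < T.+1) F i.
Proof.
move=> lt_Tn F0; rewrite (big_ord_widen n F lt_Tn) [RHS]big_mkcond /=.
by apply: eq_bigr => i _; rewrite ltnS; case: leqP => // /F0.
Qed.

Theorem theorem3p4 (R : realType) (m M : R) (m_gt0 : 0 < m) (le_mM : m <= M)
    (T dx dy : nat) (ltT_dx : (T < dx)%N) (ltT_dy : (T < dy)%N)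
    (z0 : 'cV[R]_dx * 'cV[R]_dy)
    (A : ('cV[R]_dx -> 'cV[R]_dy -> R) -> 'cV[R]_dx * 'cV[R]_dy ->
         nat -> 'cV[R]_dx * 'cV[R]_dy)
    (A_krylov : asymmetric_krylov_algorithm A) :
  exists (xt : 'cV[R]_dx) (yt : 'cV[R]_dy) (B : 'M[R]_(dx, dy)),
    [/\ (forall s : R, singular_value B s -> s != 0 -> m <= s ^+ 2 <= M),
        ~ saddle_point (bilinear_obj xt yt B) z0
      & forall zs : 'cV[R]_dx * 'cV[R]_dy,
          saddle_point (bilinear_obj xt yt B) zs ->
          rate (M / m) T * l2norm (z0 - zs) <=
            l2norm (A (bilinear_obj xt yt B) z0 (2 * T)%N - zs)].
Proof.
have [lam [w [lam_itv w_ge0 sum_w_gt0 w_extremal]]] :=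
  extremal_weights T m_gt0 le_mM.
have lam_gt0 i : 0 < lam i.
  by rewrite (lt_le_trans m_gt0) //; have /andP[] := lam_itv i.
pose s i := if (i <= T)%N then Num.sqrt (lam i) else 0.
pose a i := if (i <= T)%N then Num.sqrt (w i) else 0.
have s_supp i : (T < i)%N -> s i = 0 by rewrite /s ltnNge => /negPf->.
have a_supp i : (T < i)%N -> a i = 0 by rewrite /a ltnNge => /negPf->.
have s_sqr i : (i <= T)%N -> s i ^+ 2 = lam i.
  by rewrite /s => ->; rewrite sqr_sqrtr // ltW.
have a_sqr i : (i <= T)%N -> a i ^+ 2 = w i.
  by rewrite /a => ->; rewrite sqr_sqrtr.
have s_neq0 i : (i <= T)%N -> s i != 0.
  by rewrite /s => ->; rewrite sqrtr_eq0 -ltNge.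
have sx k : (dx <= k)%N -> s k = 0.
  by move=> le_dk; rewrite s_supp ?(leq_trans ltT_dx).
have sy k : (dy <= k)%N -> s k = 0.
  by move=> le_dk; rewrite s_supp ?(leq_trans ltT_dy).
have sum_pa (p : {poly R}) : \sum_(i < dx) (p.[s i ^+ 2] * a i) ^+ 2
    = \sum_(i < T.+1) w i * p.[lam i] ^+ 2.
  rewrite (@big_ord_supp _ T dx (fun i => (p.[s i ^+ 2] * a i) ^+ 2)) //.
    apply: eq_bigr => i _; have le_iT : (i <= T)%N by rewrite -ltnS.
    by rewrite exprMn a_sqr // s_sqr // mulrC.
  by move=> i /a_supp->; rewrite mulr0 expr0n.
have sum_a : \sum_(i < dx) a i ^+ 2 = \sum_(i < T.+1) w i.
  have := sum_pa 1; under eq_bigr do rewrite hornerC mul1r.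
  by under [RHS]eq_bigr do rewrite hornerC expr1n mulr1.
pose xt := z0.1 - \col_i a i; pose B : 'M[R]_(dx, dy) := diag_rect dx dy s.
exists xt, z0.2, B.
have u0E : z0.1 - xt = \col_i a i by rewrite /xt opprB addrC subrK.
have saddleP zs : saddle_point (bilinear_obj xt z0.2 B) zs ->
    (forall i : 'I_dx, s i * (zs.1 - xt) i 0 = 0) /\
    (forall j : 'I_dy, s j * (zs.2 - z0.2) j 0 = 0).
  case/saddle_bilinear; rewrite tr_diag_rect.
  by move=> /diag_rect_ker ? /diag_rect_ker; auto.
have [A0 A_span] := A_krylov xt z0.2 B z0.
split.
- move=> x x_sv x_neq0; have [j [_ x2]] := singular_value_diag_rect x_sv x_neq0.
  have [le_jT|lt_Tj] := leqP j T; first by rewrite x2 s_sqr.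
  by move: x_neq0; rewrite -sqrf_eq0 x2 s_supp // expr0n eqxx.
- case/saddleP => + _ => sa0; move: sum_w_gt0; rewrite -sum_a big1 ?ltxx // => i _.
  have [le_iT|/a_supp->] := leqP i T; last by rewrite expr0n.
  move/eqP: (sa0 i); rewrite u0E mxE mulf_eq0 (negPf (s_neq0 _ le_iT)) /=.
  by move/eqP->; rewrite expr0n.
move=> zs /saddleP[xs_ker ys_ker].
have [||[p [sz_p p0 uE]] [q _ vE]] :=
    @krylov_poly R dx dy s a xt z0.2 _ sx sy A_span _ _ (2 * T)%N.
- by rewrite A0.
- by rewrite A0.
set z := A _ _ _ in uE vE *.
rewrite mul2n doubleK in sz_p.
have k_ge1 : 1 <= M / m by rewrite ler_pdivlMr ?mul1r.
have /andP[r_ge0 r_le1] := rate_itv01 T k_ge1.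
have r2_le1 : rate (M / m) T ^+ 2 <= 1 by rewrite expr_le1.
rewrite -[rate _ _]ger0_norm // -sqrtr_sqr /l2norm -sqrtrM ?sqr_ge0 //.
apply: ler_wsqrtr; rewrite mulrDr; apply: lerD.
(* The kernel component [c] of the error is orthogonal to the one the algorithm
   acts on, and it contributes the same amount to both norms. *)
- pose c i := (xt - zs.1) i 0.
  have sc0 (i : 'I_dx) : s i * c i = 0.
    have -> : c i = - (zs.1 - xt) i 0 by rewrite /c -opprB mxE.
    by rewrite mulrN xs_ker oppr0.
  have ac0 (i : 'I_dx) : a i * c i = 0.
    have [le_iT|/a_supp->] := leqP i T; last by rewrite mul0r.
    move/eqP: (sc0 i); rewrite mulf_eq0 (negPf (s_neq0 _ le_iT)) /=.
    by move/eqP->; rewrite mulr0.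
  have -> : \sum_i (z0 - zs).1 i 0 ^+ 2
      = \sum_(i < dx) a i ^+ 2 + \sum_i c i ^+ 2.
    rewrite -sum_sqrD_orthogonal //; apply: eq_bigr => i _; congr (_ ^+ 2).
    by rewrite /c -[(z0 - zs).1](subrKA xt) u0E !mxE.
  have -> : \sum_i (z - zs).1 i 0 ^+ 2
      = \sum_(i < dx) (p.[s i ^+ 2] * a i) ^+ 2 + \sum_i c i ^+ 2.
    rewrite -sum_sqrD_orthogonal; last by move=> i; rewrite -mulrA ac0 mulr0.
    apply: eq_bigr => i _; congr (_ ^+ 2).
    by rewrite /c -[(z - zs).1](subrKA xt) uE !mxE.
  rewrite sum_a sum_pa mulrDr lerD ?w_extremal // ler_piMl // sumr_ge0 // => i _.
  exact: sqr_ge0.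
- rewrite mulr_sumr; apply: ler_sum => j _.
  have -> : (z - zs).2 j 0 = s j * (a j * q.[s j ^+ 2]) + (z0 - zs).2 j 0.
    by rewrite -[(z - zs).2](subrKA z0.2) vE !mxE mulrA.
  have sd0 : s j * (z0 - zs).2 j 0 = 0.
    have -> : (z0 - zs).2 j 0 = - (zs.2 - z0.2) j 0 by rewrite -opprB mxE.
    by rewrite mulrN ys_ker oppr0.
  set d := (z0 - zs).2 j 0 in sd0 *.
  rewrite sqrrD [s j * _ * d]mulrAC sd0 mul0r mul0rn addr0.
  apply: ler_wpDl; first exact: sqr_ge0.
  by rewrite ler_piMl ?sqr_ge0.
Qed.
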